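(* Let $\mathbf{G}$ be the set of rooted non-separable triangulations in which every vertex not incident to the root has degree at least $3$, and let $\mathbf{G}^*$ be the set of rooted non-separable triangulations in which every vertex has degree at least $3$. Let $G(t)$ and $G^*(t)$ be the generating functions of $\mathbf{G}$ and $\mathbf{G}^*$ respectively, where a map with $3n$ edges contributes $t^n$. Then $$G^*(t)=(1-2t)\,G(t).$$
   Context: A (planar) map is a proper embedding of a connected graph (loops and multiple edges a priori allowed) into the two-dimensional sphere, considered up to continuous (orientation-preserving) deformations. A map is rooted if one of its edges is distinguished as the root and given an orientation. A map is a triangulation if all its faces have degree $3$. A map is non-separable if it is loopless and 2-connected (the deletion of any vertex does not disconnect the map); multiple edges are allowed. A vertex is incident to the root if it is one of the two endpoints of the root edge. The number of edges of a triangulation is always a multiple of $3$; a triangulation with $3n$ edges has $2n$ faces and $n+2$ vertices. The series $G(t)$ is the unique power series in $t$ satisfying $16t^{2}G^{3}+8t(t^{2}+8t+1)G^{2}+(t^{4}+20t^{3}+50t^{2}-16t+1)G+t^{2}(t^2+11t-1)=0$. *)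

(* Defs.v *)
From HB Require Import structures.
From mathcomp Require Import all_boot all_order all_fingroup all_algebra.

Set Implicit Arguments.
Unset Strict Implicit.
Unset Printing Implicit Defensive.

(* A rooted planar map is encoded by its rotation system.  D is the set of
   darts (half-edges); a dart d is also one of the two orientations of its
   edge, with origin the vertex carrying d.
   - [sigma] turns around vertices, so vertices are the orbits of [sigma];
   - [alpha] exchanges the two darts of an edge;
   - the root dart is the oriented root edge.
   Rotation systems up to isomorphism are the same as cellular embeddings of
   connected graphs in oriented surfaces up to orientation-preserving
   homeomorphism, the surface being a sphere when Euler's relation holds.  The
   only map lost is the single vertex without edges, which cannot be rooted. *)
Section RootedMaps.

Variable D : finType.

Definition rotation := ({perm D} * {perm D} * D)%type.

Definition sigma (m : rotation) : {perm D} := m.1.1.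
Definition alpha (m : rotation) : {perm D} := m.1.2.
Definition root_dart (m : rotation) : D := m.2.

(* d |-> sigma (alpha d): products of permutations compose left to right. *)
Definition phi (m : rotation) : {perm D} := (alpha m * sigma m)%g.

Definition vertices (m : rotation) : {set {set D}} := porbits (sigma m).
Definition edges (m : rotation) : {set {set D}} := porbits (alpha m).
Definition faces (m : rotation) : {set {set D}} := porbits (phi m).

Definition adjacent (m : rotation) (u v : {set D}) : bool :=
  [exists d in u, alpha m d \in v].

(* The subgraph induced by the set of vertices V is connected. *)
Definition connected_on (m : rotation) (V : {set {set D}}) : bool :=
  [forall u in V, forall v in V,
    connect [rel x y | [&& x \in V, y \in V & adjacent m x y]] u v].

Definition is_planar_map (m : rotation) : bool :=
  [&& [forall d, (alpha m d != d) && (alpha m (alpha m d) == d)],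
      connected_on m (vertices m)
    & #|vertices m| + #|faces m| == #|edges m| + 2].

Record rooted_map := RootedMap {
  rotation_of :> rotation;
  _ : is_planar_map rotation_of
}.

HB.instance Definition _ := [isSub for rotation_of].
HB.instance Definition _ := [Finite of rooted_map by <:].

Definition map_iso (m m' : rooted_map) : bool :=
  [exists f : {perm D},
    [&& [forall d, f (sigma m d) == sigma m' (f d)],
        [forall d, f (alpha m d) == alpha m' (f d)]
      & f (root_dart m) == root_dart m']].

Lemma map_iso_equiv : equivalence_rel map_iso.
Proof.
have refl m : map_iso m m.
  by apply/existsP; exists 1%g; rewrite !perm1 eqxx andbT;
     apply/andP; split; apply/forallP=> d; rewrite !perm1.
have sym m m' : map_iso m m' -> map_iso m' m.
  case/existsP=> f /and3P[/forallP fs /forallP fa /eqP fr].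
  apply/existsP; exists (f^-1)%g; rewrite -fr permK eqxx andbT.
  apply/andP; split; apply/forallP=> d.
    by rewrite -{1}(permKV f d) -(eqP (fs _)) permK.
  by rewrite -{1}(permKV f d) -(eqP (fa _)) permK.
have trans m1 m2 m3 : map_iso m1 m2 -> map_iso m2 m3 -> map_iso m1 m3.
  case/existsP=> f /and3P[/forallP fs /forallP fa /eqP fr].
  case/existsP=> g /and3P[/forallP gs /forallP ga /eqP gr].
  apply/existsP; exists (f * g)%g; rewrite permM fr gr eqxx andbT.
  apply/andP; split; apply/forallP=> d; rewrite !permM.
    by rewrite (eqP (fs d)) (eqP (gs _)).
  by rewrite (eqP (fa d)) (eqP (ga _)).
move=> m1 m2 m3; split=> // m12.
by apply/idP/idP; apply: trans => //; apply: sym.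
Qed.

Definition triangulation (m : rooted_map) : bool :=
  [forall f in faces m, #|f| == 3].

Definition loopless (m : rooted_map) : bool :=
  [forall v in vertices m, ~~ adjacent m v v].

Definition nonseparable (m : rooted_map) : bool :=
  loopless m && [forall v in vertices m, connected_on m (vertices m :\ v)].

(* An orbit of [sigma] has as many darts as the degree of the vertex, a loop
   being counted twice. *)
Definition degree (v : {set D}) : nat := #|v|.

Definition incident_to_root (m : rooted_map) (v : {set D}) : bool :=
  (root_dart m \in v) || (alpha m (root_dart m) \in v).

Definition in_G (m : rooted_map) : bool :=
  [&& triangulation m, nonseparable m
    & [forall v in vertices m, ~~ incident_to_root m v ==> (3 <= degree v)]].

Definition in_Gstar (m : rooted_map) : bool :=
  [&& triangulation m, nonseparable m
    & [forall v in vertices m, 3 <= degree v]].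

End RootedMaps.

(* Formal power series with integer coefficients, as coefficient sequences. *)
Definition series := nat -> int.

Definition series_of_poly (p : {poly int}) : series := fun n => (p`_n)%R.

Definition series_mul (a b : series) : series :=
  fun n => (\sum_(i < n.+1) a i * b (n - i)%N)%R.

(* Number of isomorphism classes of rooted maps with e edges satisfying P; the
   2e darts are taken to be the elements of 'I_(2 * e). *)
Definition count_maps (P : forall D : finType, pred (rooted_map D)) (e : nat) :
    nat :=
  #|equivalence_partition (@map_iso 'I_(2 * e))
      [set m : rooted_map 'I_(2 * e) | P _ m]|.

(* A map with 3n edges contributes t^n.  In a triangulation 3 * #faces is the
   number of darts, so no triangulation is left out. *)
Definition triangulation_gf (P : forall D : finType, pred (rooted_map D)) :
    series :=
  fun n => ((count_maps P (3 * n))%:Z)%R.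

Definition G_series : series := triangulation_gf in_G.
Definition Gstar_series : series := triangulation_gf in_Gstar.

(* Main.v *)
Require Import Defs.
From HB Require Import structures.
From mathcomp Require Import all_boot all_order all_fingroup all_algebra.
From mathcomp Require Import zify.

(* A map of G that is not in G* has a root endpoint of degree 2, and only one:
   if both ends had degree 2, so would the third vertex of the root faces.
   Reversing the root, the difference is twice the number of maps of G whose
   root origin u has degree 2.  The two faces at u form a 2-gon around u;
   removing u and closing this 2-gon into a single edge, taken as the new root,
   is a bijection onto the maps of G with three edges fewer, because the degree
   condition does not bear on the ends of the root.  2-connectedness
   needs no separate care, as every loopless triangulation is 2-connected. *)

Set Implicit Arguments.
Unset Strict Implicit.
Unset Printing Implicit Defensive.

Import GRing.Theory.

(** * Orbits and the dart-level description of G *)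

(** Only the opening of the root edge is given by a formula on all maps; closing is obtained as a
    preimage under it, up to isomorphism. As [dart_G_open] is an equivalence, the closed map
    inherits planarity, looplessness and the degree condition without any argument of its own.
    Euler's relation in the form 6V = |D| + 12 survives because opening adds one vertex and six
    darts. Opening inserts darts inside cycles of [sigma], whereas on [phi] it replaces a single
    dart and adds two 3-cycles. Hence the closed map, and isomorphisms between closed maps, are
    built from [phi], and [sigma] is recovered as [alpha] followed by [phi]. The conditions are
    restated on darts ([dart_G]) so that they transfer along bijections between different dart sets,
    which [map_iso], confined to one set, cannot express. Membership in orbits is mostly decided by
    invariant functions, extended or restricted across the surgery. *)

Lemma leq_card_imset_ker (T U V : finType) (f : T -> {set U}) (g : T -> V)
    (A : {set T}) :
  {in A &, forall x y, g x = g y -> f x = f y} -> #|f @: A| <= #|g @: A|.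
Proof.
move=> fg; pose k v := oapp f set0 [pick x in A | g x == v].
suff -> : f @: A = k @: (g @: A) by apply: leq_imset_card.
rewrite -imset_comp; apply: eq_in_imset => x xA; rewrite /= /k.
case: pickP => [y /andP[yA /eqP gyx]|/(_ x)] /=; last by rewrite xA eqxx.
by apply: fg.
Qed.

Section Orbits.

Variables (T : finType) (s : {perm T}).

(** The main tool on orbits: an [s]-invariant function separates two orbits, and the indicator of an
    orbit is itself such a function. *)
Lemma porbit_invariant (V : Type) (S : T -> V) x y :
  (forall z, S (s z) = S z) -> y \in porbit s x -> S y = S x.
Proof.
move=> Ss /porbitP[i ->]; elim: i => [|i IHi]; first by rewrite perm1.
by rewrite expgSr permM Ss.
Qed.

Lemma mem_porbit_perm x y : (s y \in porbit s x) = (y \in porbit s x).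
Proof. by rewrite -!eq_porbit_mem -(porbit_perm s 1 y) expg1. Qed.

Lemma porbit_perm1 x : porbit s (s x) = porbit s x.
Proof. by apply/eqP; rewrite eq_porbit_mem mem_porbit_perm porbit_id. Qed.

Lemma porbits_partition : partition (porbits s) [set: T].
Proof.
have -> : porbits s = orbit 'P <[s]> @: [set: T].
  by apply/setP=> A; apply/imsetP/imsetP=> -[x _ ->]; exists x; rewrite ?porbitE.
by apply: orbit_partition; apply/actsP=> a _ x; rewrite !inE.
Qed.

Lemma card_porbits_uniform n :
  (forall x, #|porbit s x| = n) -> #|T| = #|porbits s| * n.
Proof.
move=> sz; rewrite -cardsT; apply: card_uniform_partition porbits_partition.
by move=> A /imsetP[x _ ->].
Qed.

Lemma card_porbit2 x : s (s x) = x -> s x != x -> #|porbit s x| = 2.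
Proof.
move=> sK sx; have <- : #|[set s x; x]| = 2 by rewrite cards2 sx.
apply: eq_card => y; rewrite !inE.
apply/idP/orP => [yx|[]/eqP->]; rewrite ?mem_porbit_perm ?porbit_id //.
have := @porbit_invariant _ (fun z => (z == s x) || (z == x)) x y _ yx.
rewrite eqxx orbT => /(_ _)/orP; apply=> z.
by rewrite -{2}sK !(inj_eq perm_inj) orbC.
Qed.

Lemma card_porbit3 x : s (s (s x)) = x -> s x != x -> #|porbit s x| = 3.
Proof.
move=> sK sx.
have ssx : s (s x) != x by apply: contraNneq sx => /(congr1 s); rewrite sK => <-.
have <- : #|x |: [set s x; s (s x)]| = 3.
  by rewrite cardsU1 cards2 !inE !(eq_sym x) (negPf sx) (negPf ssx) eq_sym
     (inj_eq perm_inj) sx.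
apply: eq_card => y; rewrite !inE.
apply/idP/idP => [yx|]; last by
  case/or3P=> /eqP->; rewrite ?mem_porbit_perm ?porbit_id.
have := @porbit_invariant _ (fun z => [|| z == x, z == s x | z == s (s x)]) x y _ yx.
rewrite eqxx; apply=> z.
by rewrite -{1}sK !(inj_eq perm_inj) orbC -orbA.
Qed.

Lemma iter2_porbit x : #|porbit s x| < 3 -> s (s x) = x.
Proof.
have := iter_porbit s x; have := card_porbit_neq0 s x.
by case: #|_| => [|[|[|]]] //= _ sx; rewrite sx.
Qed.

Lemma iter3_porbit x : #|porbit s x| = 3 -> s (s (s x)) = x.
Proof. by move=> sx; have := iter_porbit s x; rewrite sx. Qed.

(** Turns the degree bound into an equation on darts, which passes through isomorphisms. Degrees 1
    and 2 are both covered. *)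
Lemma card_porbit_lt3 x : (#|porbit s x| < 3) = (s (s x) == x).
Proof.
apply/idP/eqP => [/iter2_porbit //|ssx].
have [sx|sx] := eqVneq (s x) x; last by rewrite card_porbit2.
rewrite (_ : porbit s x = [set x]) ?cards1 //.
apply/setP=> y; rewrite inE; apply/idP/eqP=> [yx|->]; last exact: porbit_id.
apply/eqP; have := @porbit_invariant _ (fun z => z == x) x y _ yx; rewrite eqxx.
by apply=> z; rewrite -{1}sx (inj_eq perm_inj).
Qed.

End Orbits.

Section DartCriterion.

Variable D : finType.

Record dart_G (m : rotation D) : Prop := DartG {
  dart_alphaK : involutive (alpha m);
  dart_alpha_neq : forall d, alpha m d != d;
  dart_connected : forall S : D -> bool,
    (forall d, S (sigma m d) = S d) -> (forall d, S (alpha m d) = S d) ->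
    forall d e, S d = S e;
  dart_loopless : forall d, alpha m d \notin porbit (sigma m) d;
  dart_phi3 : forall d, phi m (phi m (phi m d)) = d;
  (* Euler's relation, where #|edges| = #|D| / 2 and #|faces| = #|D| / 3. *)
  dart_euler : 6 * #|vertices m| = #|D| + 12;
  dart_degree : forall d, sigma m (sigma m d) = d ->
    (d \in porbit (sigma m) (root_dart m)) ||
    (d \in porbit (sigma m) (alpha m (root_dart m)))
}.

Lemma phiE (m : rotation D) d : phi m d = sigma m (alpha m d).
Proof. by rewrite permM. Qed.

Section Connectivity.

Variable m : rotation D.
Hypothesis aK : involutive (alpha m).

Let V d := porbit (sigma m) d.

Lemma adjacent_alpha d : adjacent m (V d) (V (alpha m d)).
Proof. by apply/existsP; exists d; rewrite !porbit_id. Qed.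

Lemma connected_invariant :
  connected_on m (vertices m) ->
  forall S : D -> bool,
  (forall d, S (sigma m d) = S d) -> (forall d, S (alpha m d) = S d) ->
  forall d e, S d = S e.
Proof.
move=> cm S Ss Sa d e.
have Vd x : V x \in vertices m by apply: imset_f.
move: cm => /forall_inP/(_ _ (Vd d))/forall_inP/(_ _ (Vd e)) cde.
pose P := [pred v : {set D} | [exists x in v, S x]].
have PV x : P (V x) = S x.
  apply/existsP/idP => [[y /andP[yx]]|Sx]; last by exists x; rewrite porbit_id.
  by rewrite (porbit_invariant Ss yx).
rewrite -!PV; refine (closed_connect (a := P) _ cde) => u v.
case/and3P=> /imsetP[x _ ->{u}] /imsetP[y _ ->{v}] /existsP[z /andP[zx zy]].
by rewrite !inE [LHS]PV [RHS]PV -(porbit_invariant Ss zx) -(porbit_invariant Ss zy).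
Qed.

Lemma invariant_connected (W : {set {set D}}) :
  W \subset vertices m ->
  (forall C : {set D} -> bool,
     {in W &, forall u v, adjacent m u v -> C u -> C v} ->
     {in W &, forall u v, C u -> C v}) ->
  connected_on m W.
Proof.
move=> sWV H; apply/forall_inP=> u uW; apply/forall_inP=> v vW.
apply: (H (connect _ u) _ u v uW vW (connect0 _ _)) => x y xW yW xy ux.
by apply: connect_trans ux (connect1 _); rewrite /= xW yW.
Qed.

Lemma dart_connected_on :
  (forall S : D -> bool,
    (forall d, S (sigma m d) = S d) -> (forall d, S (alpha m d) = S d) ->
    forall d e, S d = S e) ->
  connected_on m (vertices m).
Proof.
move=> cm; apply: invariant_connected => // C HC.
move=> _ _ /imsetP[d _ ->] /imsetP[e _ ->].
suff -> : C (V d) = C (V e) by [].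
have Vd x : V x \in vertices m by apply: imset_f.
have Ca x : C (V x) -> C (V (alpha m x)).
  by apply: HC; rewrite ?Vd ?adjacent_alpha.
apply: (cm (fun x => C (V x))) => x; first by rewrite /V porbit_perm1.
by apply/idP/idP => [/Ca|/Ca//]; rewrite aK.
Qed.

(* A path through the deleted vertex v is rerouted along the link of v: two
   consecutive neighbours of v are joined by the third side of a face, which
   avoids v as there is no loop. *)
Lemma triangulation_nonseparable (v : {set D}) :
  (forall d, alpha m d \notin V d) ->
  (forall d, phi m (phi m (phi m d)) = d) ->
  connected_on m (vertices m) -> v \in vertices m ->
  connected_on m (vertices m :\ v).
Proof.
move=> nl phi3 cm /imsetP[d0 _ ->{v}].
apply: invariant_connected => [|C HC]; first exact: subsetDl.
have Vd x : (V x \in vertices m :\ V d0) = (V x != V d0).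
  by rewrite in_setD1 imset_f // andbT.
have Ca x : V x != V d0 -> V (alpha m x) != V d0 -> C (V (alpha m x)) = C (V x).
  move=> x0 ax0; apply/idP/idP; apply: HC; rewrite ?Vd ?adjacent_alpha //.
  by rewrite -{2}[x]aK adjacent_alpha.
have Vs x : V (sigma m x) = V x by exact: porbit_perm1.
(* A dart at the deleted vertex takes the value of its other end. Invariance under [sigma] at that
   vertex then says that consecutive neighbours agree. *)
pose S d := if V d == V d0 then C (V (alpha m d)) else C (V d).
have Va x : V x = V d0 -> V (alpha m x) != V d0.
  by move=> <-; rewrite /V eq_porbit_mem nl.
have Sc d e : S d = S e.
  apply: (connected_invariant cm) => {d e} x; rewrite /S.
    rewrite Vs; have [x0|//] := eqVneq (V x) _.
    (* [alpha m x], [sigma m x] and [e] bound one face, so [e] is its side opposite to the deleted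
       vertex. *)
    pose e := phi m (sigma m x).
    have Ve : V e = V (alpha m (sigma m x)) by rewrite /e phiE Vs.
    have Vae : V (alpha m e) = V (alpha m x).
      rewrite -[alpha m x]phi3 -/(phi m _) [phi m (alpha m x)]phiE aK.
      by rewrite -/e phiE Vs.
    rewrite -Ve -Vae Ca //; first by rewrite Ve Va // Vs.
    by rewrite Vae Va.
  have [x0|x0] := eqVneq (V x) (V d0); first by rewrite (negPf (Va _ x0)).
  by have [ax0|ax0] := eqVneq (V (alpha m x)) _; rewrite ?aK // Ca.
move=> u v; rewrite !in_setD1 => /andP[u0 /imsetP[d _ du]] /andP[v0 /imsetP[e _ ev]].
have := Sc d e; move: u0 v0; rewrite du ev /S => /negPf-> /negPf->.
by rewrite /V => ->.
Qed.

End Connectivity.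

Variable m : rooted_map D.

Lemma loopless_dartP :
  reflect (forall d, alpha m d \notin porbit (sigma m) d) (loopless m).
Proof.
apply: (iffP forall_inP) => [nl d|nl _ /imsetP[d _ ->]].
  have /nl/negP aN : porbit (sigma m) d \in vertices m by apply: imset_f.
  by apply/negP=> ad; apply: aN; apply/existsP; exists d; rewrite porbit_id.
apply/negP=> /existsP[e]; rewrite -!eq_porbit_mem => /andP[/eqP ed].
by rewrite -ed eq_porbit_mem (negPf (nl e)).
Qed.

Lemma planarP (m0 : rotation D) :
  is_planar_map m0 ->
  [/\ involutive (alpha m0), forall d, alpha m0 d != d,
      connected_on m0 (vertices m0)
    & #|vertices m0| + #|faces m0| = #|edges m0| + 2].
Proof.
by case/and3P=> /forallP aP cm /eqP eu; split=> // d;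
   case/andP: (aP d) => // _ /eqP.
Qed.

End DartCriterion.

Lemma card_edges (D : finType) (m : rotation D) :
  involutive (alpha m) -> (forall d, alpha m d != d) -> #|D| = #|edges m| * 2.
Proof. by move=> aK an; apply: card_porbits_uniform => d; apply: card_porbit2. Qed.

(** A face of degree 1 is bounded by a loop. Excluding it makes [dart_phi3] mean degree exactly
    3. *)
Lemma loopless_phi_neq (D : finType) (m : rotation D) :
  involutive (alpha m) -> (forall d, alpha m d \notin porbit (sigma m) d) ->
  forall d, phi m d != d.
Proof.
move=> aK nl d; apply: contraNneq (nl (alpha m d)) => fd.
by rewrite aK -{1}fd phiE mem_porbit_perm porbit_id.
Qed.

Lemma in_G_dart_G (D : finType) (m : rooted_map D) : in_G m -> dart_G m.
Proof.
case/and3P=> /forall_inP tr /andP[/loopless_dartP nl _] /forall_inP dg.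
have /planarP[aK an cm eu] : is_planar_map m by case: (m).
have f3 d : #|porbit (phi m) d| = 3 by apply/eqP/tr/imset_f.
split=> //.
- exact: connected_invariant.
- by move=> d; apply: iter3_porbit.
- have := card_edges aK an.
  have : #|D| = #|faces m| * 3 := card_porbits_uniform f3.
  by lia.
- move=> d /eqP; rewrite -card_porbit_lt3 ltnNge => dd.
  have /dg : porbit (sigma m) d \in vertices m by apply: imset_f.
  rewrite /degree (negPf dd) implybF negbK /incident_to_root.
  by rewrite !(porbit_sym _ d).
Qed.

Lemma dart_G_planar (D : finType) (m : rotation D) : dart_G m -> is_planar_map m.
Proof.
case=> aK an cm nl f3 eu _; apply/and3P; split.
- by apply/forallP=> d; rewrite an aK eqxx.
- exact: dart_connected_on.
have : #|D| = #|faces m| * 3.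
  apply: card_porbits_uniform => d.
  exact/card_porbit3/loopless_phi_neq.
have := card_edges aK an; lia.
Qed.

Lemma dart_G_in_G (D : finType) (m : rooted_map D) : dart_G m -> in_G m.
Proof.
case=> aK an cm nl f3 eu dg.
apply/and3P; split; last 1 first.
- apply/forall_inP=> _ /imsetP[d _ ->]; apply/implyP; rewrite /degree leqNgt.
  apply: contra; rewrite card_porbit_lt3 /incident_to_root => /eqP/dg.
  by rewrite !(porbit_sym _ d).
- apply/forall_inP=> _ /imsetP[d _ ->]; apply/eqP/card_porbit3 => //.
  exact: loopless_phi_neq.
apply/andP; split; first exact/loopless_dartP.
apply/forall_inP=> v vm; apply: triangulation_nonseparable => //.
exact: dart_connected_on.
Qed.

(** * Opening the root edge *)

Section ConjugatePermutations.

Variables (T U : finType) (s : {perm T}) (t : {perm U}) (j : T -> U).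
Hypotheses (j_inj : injective j) (jE : forall x, j (s x) = t (j x)).

Lemma porbit_conj x : porbit t (j x) = j @: porbit s x.
Proof.
have jX i : j ((s ^+ i)%g x) = (t ^+ i)%g (j x).
  by elim: i => [|i IHi]; rewrite ?perm1 // !expgSr !permM jE IHi.
apply/setP=> y; apply/porbitP/imsetP => [[i ->]|[_ /porbitP[i ->] ->]].
  by exists ((s ^+ i)%g x); rewrite ?mem_porbit.
by exists i.
Qed.

Lemma mem_porbit_conj x y : (j y \in porbit t (j x)) = (y \in porbit s x).
Proof. by rewrite porbit_conj mem_imset. Qed.

Lemma card_porbits_conj : (forall u, exists x, u = j x) -> #|porbits t| = #|porbits s|.
Proof.
move=> j_surj; rewrite -(card_imset _ (imset_inj j_inj)); congr #|pred_of_set _|.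
apply/setP=> A; apply/imsetP/imsetP => [[u _ ->]|[_ /imsetP[x _ ->] ->]].
  by have [x ->] := j_surj u; exists (porbit s x); rewrite ?imset_f ?porbit_conj.
by exists (j x); rewrite ?porbit_conj.
Qed.

End ConjugatePermutations.

Lemma restrict_perm (T U : finType) (t : {perm U}) (j : T -> U) :
  injective j -> (forall x, exists y, t (j x) = j y) ->
  exists s : {perm T}, forall x, j (s x) = t (j x).
Proof.
move=> j_inj /fin_all_exists[h hE].
have h_inj : injective h.
  by move=> x y hxy; apply/j_inj/(@perm_inj _ t); rewrite !hE hxy.
by exists (perm h_inj) => x; rewrite permE hE.
Qed.

Record rot_isom (D E : finType) (m : rotation D) (n : rotation E) (f : D -> E) : Prop :=
  RotIsom {
  rot_isom_bij : bijective f;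
  rot_isom_sigma : forall d, f (sigma m d) = sigma n (f d);
  rot_isom_alpha : forall d, f (alpha m d) = alpha n (f d);
  rot_isom_root : f (root_dart m) = root_dart n
}.

Lemma rot_isom_phi (D E : finType) (m : rotation D) (n : rotation E) f :
  rot_isom m n f -> forall d, f (phi m d) = phi n (f d).
Proof. by move=> i d; rewrite !phiE (rot_isom_sigma i) (rot_isom_alpha i). Qed.

Lemma rot_isom_inv (D E : finType) (m : rotation D) (n : rotation E) f :
  rot_isom m n f -> exists g, rot_isom n m g.
Proof.
case=> -[g fK gK] fs fa fr; exists g; split; first by exists f.
- by move=> d; rewrite -{1}[d]gK -fs fK.
- by move=> d; rewrite -{1}[d]gK -fa fK.
by rewrite -fr fK.
Qed.

Lemma rot_isom_comp (D E F : finType) (m : rotation D) (n : rotation E)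
    (p : rotation F) f g :
  rot_isom m n f -> rot_isom n p g -> rot_isom m p (g \o f).
Proof.
move=> [bf fs fa fr] [bg gs ga gr]; split; first exact: bij_comp.
- by move=> d /=; rewrite fs gs.
- by move=> d /=; rewrite fa ga.
by rewrite /= fr gr.
Qed.

Lemma map_isoP (D : finType) (m n : rooted_map D) :
  reflect (exists f, rot_isom m n f) (map_iso m n).
Proof.
apply: (iffP existsP) => [[f /and3P[/forallP fs /forallP fa /eqP fr]]|[f [bf fs fa fr]]].
  by exists f; split=> // [|d|d]; [exists f^-1%g; [apply: permK|apply: permKV] |
     apply/eqP/fs | apply/eqP/fa].
exists (perm (bij_inj bf)); rewrite permE fr eqxx andbT.
by apply/andP; split; apply/forallP=> d; rewrite !permE ?fs ?fa.
Qed.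

Lemma rot_isom_dart_G (D E : finType) (m : rotation D) (n : rotation E) f :
  rot_isom m n f -> dart_G m -> dart_G n.
Proof.
case=> bf fs fa fr [aK an cm nl f3 eu dg].
have f_inj := bij_inj bf.
have surj e : exists d, e = f d by case: bf => g fK gK; exists (g e).
have memf := mem_porbit_conj f_inj fs.
have fphi d : phi n (f d) = f (phi m d) by rewrite !phiE fs fa.
split.
- by move=> e; have [d ->] := surj e; rewrite -!fa aK.
- by move=> e; have [d ->] := surj e; rewrite -!fa (inj_eq f_inj).
- move=> S Ss Sa e1 e2; have [d1 ->] := surj e1; have [d2 ->] := surj e2.
  by apply: (cm (fun d => S (f d))) => d; rewrite ?fs ?fa.
- by move=> e; have [d ->] := surj e; rewrite -fa memf.
- by move=> e; have [d ->] := surj e; rewrite !fphi f3.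
- by rewrite /vertices (card_porbits_conj f_inj fs surj) -(bij_eq_card bf).
move=> e; have [d ->] := surj e; rewrite -!fs => /f_inj/dg.
by rewrite -fr -fa !memf.
Qed.

Section Opening.

Variable D : finType.

(* Darts of the map whose root edge, from b to c, is opened into a 2-gon with
   a new vertex u inside.  The new edges are indexed by option bool: None is
   ub (the new root), Some false is uc, Some true is a second edge bc.  The
   boolean is false on the darts leaving u, and on the dart of bc at b. *)
Definition open_dart : finType := (D + option bool * bool)%type.

Local Notation dR := (inr (None, false) : open_dart).
Local Notation dR' := (inr (None, true) : open_dart).
Local Notation dX := (inr (Some false, false) : open_dart).
Local Notation dX' := (inr (Some false, true) : open_dart).
Local Notation dY := (inr (Some true, false) : open_dart).
Local Notation dY' := (inr (Some true, true) : open_dart).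

Implicit Types (m : rotation D) (t : open_dart).

Definition open_alpha_fun m t : open_dart :=
  match t with
  | inl d => inl (alpha m d)
  | inr (e, b) => inr (e, ~~ b)
  end.

(** With r the root dart at b and z its reverse at c, the cycle at b becomes r, [dR'], [dY], then
    the old successor of r; at c, [dY'] and [dX'] are inserted just before z; u carries [dR] and
    [dX]. The test in the [dY] case matters only when z directly follows r, so that the root is a
    loop; it keeps the function injective for every [m]. *)
Definition open_sigma_fun m t : open_dart :=
  match t with
  | inl d => if d == root_dart m then dR'
             else if sigma m d == alpha m (root_dart m) then dY'
             else inl (sigma m d)
  | inr (None, false) => dX
  | inr (None, true) => dY
  | inr (Some false, false) => dR
  | inr (Some false, true) => inl (alpha m (root_dart m))
  | inr (Some true, false) =>
      if sigma m (root_dart m) == alpha m (root_dart m) then dY'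
      else inl (sigma m (root_dart m))
  | inr (Some true, true) => dX'
  end.

Lemma open_alpha_inj m : injective (open_alpha_fun m).
Proof.
move=> [d|[e b]] [d'|[e' b']] //= []; first by move/perm_inj->.
by move=> -> /negb_inj->.
Qed.

Lemma open_sigma_inj m : injective (open_sigma_fun m).
Proof.
have sI := @perm_inj _ (sigma m).
move=> [d|[[[]|] []]] [d'|[[[]|] []]] //=; repeat case: eqP => //.
all: try by move=> *; congruence.
all: try by move=> *; congr inl; apply: sI; congruence.
all: try by move=> ? ? ? [] // /sI ?; congruence.
- by move=> rz dz []; apply: sI; rewrite rz.
- by move=> dz dr rz; case: dr; apply: sI; rewrite rz.
Qed.

Definition open_map m : rotation open_dart :=
  (perm (@open_sigma_inj m), perm (@open_alpha_inj m), dR).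

Lemma open_sigmaE m t : sigma (open_map m) t = open_sigma_fun m t.
Proof. by rewrite permE. Qed.

Lemma open_alphaE m t : alpha (open_map m) t = open_alpha_fun m t.
Proof. by rewrite permE. Qed.

(** Extends a function on the old vertices to the new map: [a] is its value at u, and the new darts
    at b and c take the values there. *)
Definition open_ext (T : Type) m (a : T) (S : D -> T) t : T :=
  match t with
  | inl d => S d
  | inr (Some false, false) | inr (None, false) => a
  | inr (Some true, false) | inr (None, true) => S (root_dart m)
  | inr (_, true) => S (alpha m (root_dart m))
  end.

Lemma open_ext_sigma (T : Type) m (a : T) (S : D -> T) :
  (forall d, S (sigma m d) = S d) ->
  forall t, open_ext m a S (sigma (open_map m) t) = open_ext m a S t.
Proof.
move=> Ss t; rewrite open_sigmaE.
case: t => [d|[[[]|] []]] //=; last first.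
  by case: eqP => /= [<-|_]; rewrite Ss.
by case: eqP => [->|_] //; case: eqP => /= [<-|_]; rewrite Ss.
Qed.

Lemma open_restrict_sigma (T : Type) m (S : open_dart -> T) :
  (forall t, S (sigma (open_map m) t) = S t) ->
  [/\ S dX = S dR, S dY = S dR', S dY' = S dX',
      S dR' = S (inl (root_dart m)) & S dX' = S (inl (alpha m (root_dart m)))]
  /\ (forall d, S (inl (sigma m d)) = S (inl d)).
Proof.
move=> Ss; have Sr : S (inl (root_dart m)) = S dR'.
  by rewrite -Ss open_sigmaE /= eqxx.
have SR : S dR = S dX by rewrite -Ss open_sigmaE.
have SR' : S dR' = S dY by rewrite -Ss open_sigmaE.
have SY' : S dY' = S dX' by rewrite -Ss open_sigmaE.
have SX' : S dX' = S (inl (alpha m (root_dart m))) by rewrite -Ss open_sigmaE.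
do 2?split=> // d; have := Ss (inl d); rewrite open_sigmaE /=.
case: eqP => [->|_]; last by case: eqP => [-> <-|//]; rewrite SY' SX'.
have := Ss dY; rewrite open_sigmaE /= -SR' -Sr.
by case: eqP => [->|_ ->//]; rewrite SY' SX'.
Qed.

Section Porbits.

Variable m : rotation D.

(** Each direction transports the indicator of an orbit: it is extended by [open_ext] one way and
    restricted to the old darts the other way. *)
Lemma mem_porbit_open d e :
  (inl e \in porbit (sigma (open_map m)) (inl d)) = (e \in porbit (sigma m) d).
Proof.
apply/idP/idP => [ed|].
  pose S x := x \in porbit (sigma m) d.
  have Se x : S (sigma m x) = S x by exact: mem_porbit_perm.
  have := porbit_invariant (open_ext_sigma false Se) ed.
  by rewrite /= [RHS]porbit_id.
pose S t := t \in porbit (sigma (open_map m)) (inl d).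
have [t|_ Se] := @open_restrict_sigma _ m S.
  exact: mem_porbit_perm.
by move/(porbit_invariant Se); rewrite /S porbit_id => ->.
Qed.

Let V t := porbit (sigma (open_map m)) t.

Lemma porbit_open :
  [/\ V dX = V dR, V dY = V dR', V dY' = V dX',
      V dR' = V (inl (root_dart m)) & V dX' = V (inl (alpha m (root_dart m)))].
Proof. by case: (@open_restrict_sigma _ m V) => // t; exact: porbit_perm1. Qed.

Lemma mem_porbit_openR t : (t \in V dR) = (t == dR) || (t == dX).
Proof.
apply/idP/orP => [tR|[] /eqP->]; [|exact: porbit_id|].
  have := porbit_invariant (@open_ext_sigma _ m true (fun=> false) _) tR.
  by move/(_ (fun=> erefl)); case: t {tR} => [d|[[[]|] []]] //=; auto.
by rewrite -eq_porbit_mem; case: porbit_open => /eqP.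
Qed.

Lemma card_vertices_open : #|vertices (open_map m)| = #|vertices m|.+1.
Proof.
have [XR YR' YX' R'r X'z] := porbit_open.
pose Vl d := V (inl d).
have VlE d e : (Vl d == Vl e) = (porbit (sigma m) d == porbit (sigma m) e).
  by rewrite !eq_porbit_mem mem_porbit_open.
have -> : vertices (open_map m) = V dR |: Vl @: [set: D].
  apply/setP=> A; rewrite in_setU1; apply/imsetP/orP => [[t _ ->]|]; last first.
    by case=> [/eqP->|/imsetP[d _ ->]]; [exists dR | exists (inl d)].
  rewrite -[porbit _ t]/(V t).
  case: t => [d|[[[]|] []]]; rewrite ?XR ?YR' ?YX' ?R'r ?X'z ?eqxx; auto;
    by right; apply: imset_f.
rewrite cardsU1 (_ : _ \notin _) ?add1n; last first.
  by apply/imsetP=> -[d _ /esym/eqP]; rewrite eq_porbit_mem mem_porbit_openR.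
congr _.+1; rewrite /vertices /porbits (_ : _ @: D = porbit (sigma m) @: [set: D]).
  apply/eqP; rewrite eqn_leq !leq_card_imset_ker // => d e _ _ /eqP.
    by rewrite VlE => /eqP.
  by rewrite -VlE => /eqP.
by apply/setP=> A; apply/imsetP/imsetP => -[d _ ->]; exists d.
Qed.

Lemma loopless_open :
  (forall t, alpha (open_map m) t \notin V t) <->
  (forall d, alpha m d \notin porbit (sigma m) d).
Proof.
have [XR YR' YX' R'r X'z] := porbit_open.
split=> nl => [d|t].
  by rewrite -mem_porbit_open; have := nl (inl d); rewrite open_alphaE.
rewrite open_alphaE; case: t => [d|[[[]|] []]] /=.
- by rewrite mem_porbit_open.
- by rewrite YX' X'z -eq_porbit_mem -/(V _) YR' R'r eq_porbit_mem mem_porbit_open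
     porbit_sym.
- by rewrite YR' R'r -eq_porbit_mem -/(V _) YX' X'z eq_porbit_mem mem_porbit_open.
- by rewrite X'z -eq_porbit_mem -/(V _) XR eq_sym eq_porbit_mem mem_porbit_openR.
- by rewrite XR mem_porbit_openR.
- by rewrite porbit_sym mem_porbit_openR.
- by rewrite mem_porbit_openR.
Qed.

End Porbits.

(* The face of m containing z := alpha m (root_dart m) becomes, in open_map m,
   the face containing dY', while inl z now borders the 2-gon.  Replacing z by
   dY' thus carries phi m to phi (open_map m). *)
Definition open_face_dart m d : open_dart :=
  if d == alpha m (root_dart m) then dY' else inl d.

Lemma open_face_dart_inj m : injective (open_face_dart m).
Proof.
move=> d e; rewrite /open_face_dart.
by case: eqP => [->|_]; case: eqP => [->|_] // [].
Qed.

Lemma phi_open_face m d :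
  involutive (alpha m) -> (forall d, alpha m d \notin porbit (sigma m) d) ->
  phi (open_map m) (open_face_dart m d) = open_face_dart m (phi m d).
Proof.
move=> aK nl; rewrite phiE open_alphaE open_sigmaE phiE /open_face_dart.
have nrz : (sigma m (root_dart m) == alpha m (root_dart m)) = false.
  by apply: contraNF (nl (root_dart m)) => /eqP<-; rewrite mem_porbit_perm porbit_id.
have [->|dz] := eqVneq d; first by rewrite /= aK !nrz.
by rewrite /= (can2_eq aK aK) (negPf dz).
Qed.

(** The six darts outside the image of [open_face_dart] form the two triangles at u, checked by
    computation; on the image, [phi] is conjugate to that of [m]. *)
Lemma phi3_open m :
  involutive (alpha m) -> (forall d, alpha m d \notin porbit (sigma m) d) ->
  (forall t, phi (open_map m) (phi (open_map m) (phi (open_map m) t)) = t) <->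
  (forall d, phi m (phi m (phi m d)) = d).
Proof.
move=> aK nl; have phij d := phi_open_face d aK nl.
split=> [f3 d|f3 t]; first by apply: (@open_face_dart_inj m); rewrite -!phij f3.
have f3j d : phi (open_map m) (phi (open_map m) (phi (open_map m)
    (open_face_dart m d))) = open_face_dart m d by rewrite !phij f3.
have openE := (phiE, open_alphaE, open_sigmaE).
have f3Y' : phi (open_map m) (phi (open_map m) (phi (open_map m) dY')) = dY'.
  by have := f3j (alpha m (root_dart m)); rewrite /open_face_dart eqxx.
case: t => [d|[[[]|] []]] //; do ?by rewrite !openE /= ?aK ?eqxx.
have [->|dz] := eqVneq d (alpha m (root_dart m)).
  by rewrite !openE /= aK eqxx.
by have := f3j d; rewrite /open_face_dart (negPf dz).
Qed.

Lemma card_open_dart : #|open_dart| = #|D| + 6.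
Proof. by rewrite card_sum card_prod card_option !card_bool. Qed.

Lemma dart_G_open m : dart_G (open_map m) <-> dart_G m.
Proof.
have [_ YR' _ R'r X'z] := porbit_open m.
(* Only the two ends of the root gain darts, so the rotation is unchanged at every other vertex. *)
have degree_open d : d \notin porbit (sigma m) (root_dart m) ->
    d \notin porbit (sigma m) (alpha m (root_dart m)) ->
    sigma (open_map m) (sigma (open_map m) (inl d)) = inl (sigma m (sigma m d)).
  have neq e f : f \notin porbit (sigma m) e -> (f == e) = false.
    by apply: contraNF => /eqP->; apply: porbit_id.
  move=> dr dz; rewrite [sigma _ (inl d)]open_sigmaE /= (neq _ _ dr) neq ?mem_porbit_perm //.
  by rewrite open_sigmaE /= !neq ?mem_porbit_perm.
split=> -[aK an cm nl f3 eu dg].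
- have {}aK : involutive (alpha m).
    by move=> d; have := aK (inl d); rewrite !open_alphaE => -[].
  have {}nl := (loopless_open m).1 nl.
  split=> //.
  + by move=> d; have := an (inl d); rewrite open_alphaE.
  + move=> S Ss Sa d e.
    (* Giving u the value at b makes the extension constant along the three new edges, since [S]
       already agrees at b and c. *)
    apply: (cm (open_ext m (S (root_dart m)) S) _ _ (inl d) (inl e)) => t.
      exact: open_ext_sigma.
    by rewrite open_alphaE; case: t => [x|[[[]|] []]] /=.
  + exact/(phi3_open aK nl).
  + by have := card_vertices_open m; have := card_open_dart; lia.
  + move=> d dd; apply/norP=> -[dr dz].
    have := degree_open d dr dz; rewrite dd => /dg/orP[].
      by rewrite mem_porbit_openR.
    by rewrite open_alphaE /= R'r mem_porbit_open (negPf dr).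
- split=> //.
  + by move=> t; rewrite !open_alphaE; case: t => [d|[e []]] /=; rewrite ?aK.
  + move=> t; rewrite open_alphaE; apply/eqP.
    by case: t => [d|[e []]] //= [] /eqP; rewrite (negPf (an d)).
  + move=> S Ss Sa.
    have [[SX SY SY' SR' SX'] Se] := open_restrict_sigma Ss.
    have Sl d e : S (inl d) = S (inl e).
      apply: (cm (fun d => S (inl d))) => // x.
      by have := Sa (inl x); rewrite open_alphaE.
    suff St t : S t = S (inl (root_dart m)) by move=> t u; rewrite !St.
    have SR : S dR = S dR' by have := Sa dR; rewrite open_alphaE.
    by case: t => [d|[[[]|] []]]; rewrite ?SX ?SR ?SY ?SY' ?SX' ?SR' //; apply: Sl.
  + exact/loopless_open.
  + exact/phi3_open.
  + by rewrite card_vertices_open card_open_dart; lia.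
  + move=> t tt; rewrite open_alphaE /= mem_porbit_openR.
    (* c is no longer an end of the root, so its degree must be shown to be at least 3. Small degree
       is a [sigma]-invariant property, hence may be tested at [dY'], from which two steps of
       [sigma] lead to [inl] of the old reversed root. *)
    have Sbig : forall t, (sigma (open_map m) (sigma (open_map m) (sigma (open_map m) t))
        == sigma (open_map m) t) = (sigma (open_map m) (sigma (open_map m) t) == t).
      by move=> u; rewrite (inj_eq perm_inj).
    have [[_ _ SY' _ SX'] _] := open_restrict_sigma Sbig.
    have SzF : sigma (open_map m) (sigma (open_map m) (inl (alpha m (root_dart m))))
        == inl (alpha m (root_dart m)) = false.
      by rewrite -SX' -SY' !open_sigmaE.
    move: tt; case: t => [d|[[[]|] []]] // /eqP.
    + have [dr|dr] := boolP (d \in porbit (sigma m) (root_dart m)).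
        by rewrite R'r mem_porbit_open dr.
      have [dz|dz] := boolP (d \in porbit (sigma m) (alpha m (root_dart m))).
        move: dz; rewrite -mem_porbit_open => /(porbit_invariant Sbig) ->.
        by rewrite SzF.
      by rewrite degree_open // => /eqP[/dg]; rewrite (negPf dr) (negPf dz).
    + by rewrite SY' SX' SzF.
    + by rewrite -eq_porbit_mem YR' eqxx orbT.
    + by rewrite SX' SzF.
    by rewrite porbit_id orbT.
Qed.

End Opening.

(** * Closing a root vertex of degree 2 *)

Lemma rot_isom_open (D E : finType) (m : rotation D) (n : rotation E) f :
  rot_isom m n f -> exists g, rot_isom (open_map m) (open_map n) g.
Proof.
case=> bf fs fa fr; have f_inj := bij_inj bf.
pose g (t : open_dart D) : open_dart E :=
  match t with inl d => inl (f d) | inr u => inr u end.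
have gE b t u : g (if b then t else u) = if b then g t else g u by case: b.
exists g; split=> // [|t|t]; last 1 first.
- by rewrite !open_alphaE; case: t => [d|[]] //=; rewrite fa.
- case: bf => h fK hK.
  exists (fun t => match t with inl d => inl (h d) | inr u => inr u end).
    by case=> [d|//] /=; rewrite fK.
  by case=> [d|//] /=; rewrite hK.
rewrite !open_sigmaE; case: t => [d|[[[]|] []]] //=; rewrite ?gE ?gE /=.
- by rewrite -fr -!fs -fa !(inj_eq f_inj).
- by rewrite -fr -!fs -fa !(inj_eq f_inj).
by rewrite -fr -fa.
Qed.

(** The new darts are reached from the root by [sigma] and [alpha], so an isomorphism fixes them and
    restricts to the old darts. Its compatibility with [sigma] comes from that with [phi], which
    [open_face_dart] intertwines. *)
Lemma open_rot_isom (D E : finType) (m : rotation D) (n : rotation E) g :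
  dart_G m -> dart_G n -> rot_isom (open_map m) (open_map n) g ->
  exists f, rot_isom m n f.
Proof.
move=> mG nG ig; have [bg gs ga gr] := ig; have g_inj := bij_inj bg.
have gR : g (inr (None, false)) = inr (None, false) by [].
have gX : g (inr (Some false, false)) = inr (Some false, false).
  by have := gs (inr (None, false)); rewrite gR !open_sigmaE.
have gR' : g (inr (None, true)) = inr (None, true).
  by have := ga (inr (None, false)); rewrite gR !open_alphaE.
have gY : g (inr (Some true, false)) = inr (Some true, false).
  by have := gs (inr (None, true)); rewrite gR' !open_sigmaE.
have g_new u : g (inr u) = inr u.
  case: u => [[[]|] []] //.
    by have := ga (inr (Some true, false)); rewrite gY !open_alphaE.
  by have := ga (inr (Some false, false)); rewrite gX !open_alphaE.
have /fin_all_exists[f gf] : forall d, exists e, g (inl d) = inl e.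
  move=> d; case gd: (g (inl d)) => [e|u]; first by exists e.
  by have := g_inj (inl d) (inr u); rewrite g_new => /(_ gd).
have f_inj : injective f.
  by move=> d e fde; have := g_inj (inl d) (inl e); rewrite !gf fde => /(_ erefl)[].
have fa d : f (alpha m d) = alpha n (f d).
  by have := ga (inl d); rewrite !open_alphaE /= !gf => -[].
have fr : f (root_dart m) = root_dart n.
  have := gs (inl (root_dart m)); rewrite !open_sigmaE /= eqxx gR' gf /=.
  by do 2?case: eqP.
have gj d : g (open_face_dart m d) = open_face_dart n (f d).
  rewrite /open_face_dart -fr -fa (inj_eq f_inj).
  by case: ifP => _; rewrite ?g_new ?gf.
have fphi d : f (phi m d) = phi n (f d).
  apply: (@open_face_dart_inj _ n).
  rewrite -gj -!phi_open_face; try exact: dart_alphaK; try exact: dart_loopless.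
  by rewrite (rot_isom_phi ig) gj.
exists f; split=> // [|d].
  apply: inj_card_bij => //.
  by have := bij_eq_card bg; rewrite !card_open_dart => /addIn->.
by rewrite -{1}[d](dart_alphaK mG) -phiE fphi phiE -fa (dart_alphaK mG).
Qed.

Section Closing.

Variables (D E : finType) (m : rotation E).
Hypotheses (mG : dart_G m) (card_E : #|E| = #|D| + 6).
Let s := sigma m.
Let a := alpha m.
Let r := root_dart m.
Hypothesis root2 : s (s r) = r.
(** The letters anticipate [open_map]: [r] and [x] are the darts at u, [a r] and [y] lie at b, [a x]
    and [a y] at c. The edge of [z] is the side of the 2-gon that is kept; the edge of [y] is the
    side that disappears. *)
Let x := s r.
Let y := s (a r).
Let z := s (a x).
Let V := porbit s.

Let aK : involutive a := dart_alphaK mG.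
Let Vs d : V (s d) = V d. Proof. exact: porbit_perm1. Qed.
Let nl d : V (a d) != V d.
Proof. by rewrite /V eq_porbit_mem (dart_loopless mG). Qed.
Let f3 d : s (a (s (a (s (a d))))) = d.
Proof. by have := dart_phi3 mG d; rewrite !phiE. Qed.

Let s_ay : s (a y) = a x.
Proof.
apply: (can_inj aK); rewrite aK; apply: (@perm_inj _ s).
by rewrite -/x /y f3 [RHS]root2.
Qed.

Let s_az : s (a z) = a r.
Proof. by apply: (can_inj aK); apply: (@perm_inj _ s); rewrite /z f3 aK. Qed.

Let Vx : V x = V r. Proof. exact: Vs. Qed.
Let Vy : V y = V (a r). Proof. exact: Vs. Qed.
Let Vay : V (a y) = V (a x). Proof. by rewrite -s_ay Vs. Qed.
Let Vz : V z = V (a x). Proof. exact: Vs. Qed.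

Let nVar : V (a r) != V r. Proof. exact: nl. Qed.
Let nVax : V (a x) != V r. Proof. by rewrite -Vx nl. Qed.
Let nVaxr : V (a x) != V (a r). Proof. by rewrite -Vay -Vy nl. Qed.

Let xr : x != r.
Proof.
apply/eqP=> xr; have := nl y; rewrite Vay Vy xr.
by rewrite eqxx.
Qed.

Let yar : y != a r.
Proof.
by apply/eqP=> yar; have := nVax; rewrite -s_ay yar aK Vs eqxx.
Qed.

Let axay : a x != a y.
Proof. by rewrite (can_eq aK); apply: contraNneq nVar => xy; rewrite -Vy -xy Vx. Qed.

Let zax : z != a x.
Proof. by rewrite -[in X in _ != X]s_ay /z (inj_eq perm_inj). Qed.

(** This is where the degree condition enters: if the two sides of the 2-gon were the same edge, c
    would have degree 2 without being an end of the root. *)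
Let zay : z != a y.
Proof.
apply/eqP=> zay; have : s (s (a y)) = a y by rewrite s_ay -/z zay.
move/(dart_degree mG); rewrite -!eq_porbit_mem -/(V _) -/a -/s -/r.
by rewrite -/(V r) -/(V (a r)) Vay (negPf nVax) (negPf nVaxr).
Qed.

Lemma root_ends_degree : s (s (a r)) != a r.
Proof.
apply/eqP=> sy; have := s_az; rewrite -[RHS]sy => /perm_inj azy.
by have := zay; rewrite /y -azy aK eqxx.
Qed.

Definition new_dart (u : option bool * bool) : E :=
  let d := match u.1 with None => r | Some false => x | Some true => y end in
  if u.2 then a d else d.

(** The three vertices u, b, c are distinct, which separates all pairs but those sharing a vertex;
    these are [xr], [yar] and [axay]. *)
Lemma new_dart_inj : injective new_dart.
Proof.
have neqV d e : V d != V e -> d <> e by move=> /eqP nV /(congr1 V).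
have nVra : V r != V (a r) by rewrite eq_sym.
have nVrax : V r != V (a x) by rewrite eq_sym.
have nVarx : V (a r) != V (a x) by rewrite eq_sym.
have sym (T : eqType) (b c : T) : b != c -> c <> b by move=> /eqP bc /esym.
move=> [[[]|] []] [[[]|] []] //=; rewrite /new_dart /= => e; exfalso; move: e;
  try (by apply/eqP); try (by apply: sym);
  by apply: neqV; rewrite ?Vay ?Vy ?Vx.
Qed.
(** [D] is only known by its cardinality, so it is identified with the complement of the six new
    darts by enumeration. *)
Lemma old_dart_embedding : exists i : D -> E,
  [/\ injective i, forall d u, i d != new_dart u
    & forall e, (forall u, e != new_dart u) -> exists d, i d = e].
Proof.
pose C := ~: [set new_dart u | u in [set: option bool * bool]].
have cC : #|D| = #|C|.
  have := cardsC [set new_dart u | u in [set: option bool * bool]].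
  rewrite -/C card_imset ?cardsT ?card_E; last exact: new_dart_inj.
  by rewrite card_prod card_option !card_bool; lia.
have memC e : (e \in C) = [forall u, e != new_dart u].
  rewrite inE; apply/idP/forallP => [eC u|eC].
    by apply: contra eC => /eqP->; apply: imset_f.
  by apply/imsetP=> -[u _ eu]; have := eC u; rewrite eu eqxx.
exists (fun d => enum_val (cast_ord cC (enum_rank d))); split.
- by move=> d e /enum_val_inj/cast_ord_inj/enum_rank_inj.
- by move=> d; apply/forallP; rewrite -memC enum_valP.
move=> e /forallP; rewrite -memC => eC.
exists (enum_val (cast_ord (esym cC) (enum_rank_in eC e))).
by rewrite enum_valK cast_ordKV enum_rankK_in.
Qed.

(** Removing darts from [sigma] would mean bypassing them in its cycles. For [phi] it is enough to
    drop the two faces at u and to let [a y], on the outer side of the 2-gon, stand for [z]. *)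
Lemma close_map : exists (n : rotation D) g, rot_isom (open_map n) m g.
Proof.
have [i [i_inj i_new i_old]] := old_dart_embedding.
have z_new u : z != new_dart u.
  case: u => [[[]|] []]; rewrite /new_dart //=; apply/eqP.
  - by move=> zy; have := nVaxr; rewrite -Vz zy Vy eqxx.
  - by move=> zx; have := nVax; rewrite -Vz zx Vx eqxx.
  - by move=> zr; have := nVaxr; rewrite -Vz zr eqxx.
  by move=> zr; have := nVax; rewrite -Vz zr eqxx.
have a_new u : a (new_dart u) = new_dart (u.1, ~~ u.2).
  by case: u => e []; rewrite /new_dart //= aK.
(* The new root runs from b to c along the kept side, and [z] is its reverse. *)
have [r' ir'] : exists r', i r' = a z.
  apply: i_old => u; apply/eqP=> azu; have := z_new (u.1, ~~ u.2).
  by rewrite -a_new -azu aK eqxx.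
have [a' ia'] : exists a' : {perm D}, forall d, i (a' d) = a (i d).
  apply: restrict_perm => // d.
  have [u|d' <-] := i_old (a (i d)); last by exists d'.
  apply/eqP=> au; have := i_new d (u.1, ~~ u.2).
  by rewrite -a_new -au aK eqxx.
have ia'r : i (a' r') = z by rewrite ia' ir' aK.
pose j d := if d == a' r' then a y else i d.
have i_ay d : i d != a y by have := i_new d (Some true, true).
have j_inj : injective j.
  move=> d e; rewrite /j; case: eqP => [->|_]; case: eqP => [->|_] //.
  - by move/eqP; rewrite eq_sym (negPf (i_ay _)).
  - by move/eqP; rewrite (negPf (i_ay _)).
  exact: i_inj.
(* The six darts of the two faces at u. [phi] permutes them, and [j] reaches exactly all the
   others. *)
pose F : pred E := [pred e | e \in [:: r; y; a x; x; z; a r]].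
have F_phi e : F (phi m e) -> F e.
  have fE : [/\ phi m r = y, phi m y = a x, phi m (a x) = r,
     phi m x = z & phi m z = a r /\ phi m (a r) = x].
    by rewrite !phiE -/a -/s !aK.
  case: fE => f1 f2 f_3 f4 [f5 f6]; rewrite /F /= !inE.
  case/or4P=> [|||/or3P[]] /eqP; [rewrite -f_3 | rewrite -f1 | rewrite -f2
    | rewrite -f6 | rewrite -f4 | rewrite -f5] => /perm_inj->; rewrite eqxx ?orbT //.
have jF d : ~~ F (j d).
  rewrite /F /= !inE /j; have [_|dz] := eqVneq d; last first.
    rewrite -ia'r (inj_eq i_inj) (negPf dz) !negb_or.
    by rewrite (i_new d (None, false)) (i_new d (None, true))
       (i_new d (Some false, false)) (i_new d (Some false, true))
       (i_new d (Some true, false)).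
  have ay_new u : u != (Some true, true) -> a y != new_dart u.
    by apply: contraNneq => /(@new_dart_inj (Some true, true)) <-.
  rewrite !negb_or (eq_sym _ z) zay.
  by rewrite (ay_new (None, false)) // (ay_new (None, true)) //
     (ay_new (Some false, false)) // (ay_new (Some false, true)) //
     (ay_new (Some true, false)).
have Fj e : ~~ F e -> exists d, j d = e.
  rewrite /F /= !inE !negb_or => /and5P[er ey eax ex /andP[ez ear]].
  have [->|eay] := eqVneq e (a y); first by exists (a' r'); rewrite /j eqxx.
  have [u|d de] := i_old e; first by case: u => [[[]|] []].
  by exists d; rewrite /j -(inj_eq i_inj) ia'r de (negPf ez).
have [f' jf'] : exists f' : {perm D}, forall d, j (f' d) = phi m (j d).
  apply: restrict_perm => // d.
  by have [|e <-] := Fj (phi m (j d)); [apply: contra (@F_phi _) _ | exists e].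
pose n : rotation D := ((a' * f')%g, a', r').
have sn d : sigma n d = f' (a' d) by rewrite permM.
pose g (t : open_dart D) := match t with inl d => i d | inr u => new_dart u end.
have g_inj : injective g.
  case=> [d|u] [e|v] //=; first by move/i_inj->.
  - by move/eqP; rewrite (negPf (i_new _ _)).
  - by move/eqP; rewrite eq_sym (negPf (i_new _ _)).
  by move/new_dart_inj->.
exists n, g; split=> //.
- by apply: inj_card_bij => //; rewrite card_open_dart card_E.
- have j_old d : d != a' r' -> j d = i d by rewrite /j => /negPf->.
  have i_sigma d : d != r' -> s (i d) = j (sigma n d).
    move=> dr; rewrite sn jf' j_old ?ia' ?phiE ?aK //.
    by rewrite (inj_eq perm_inj).
  have sr : s y = j (sigma n r') by rewrite sn jf' /j eqxx phiE aK.
  have jE d : j d = g (if d == a' r' then inr (Some true, true) else inl d).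
    by rewrite /j; case: ifP.
  move=> t; rewrite open_sigmaE; case: t => [d|[[[]|] []]] //=.
  + have [->|dr] := eqVneq d r'; first by rewrite ir' s_az.
    by rewrite i_sigma // jE.
  by rewrite -[RHS]/(s y) sr jE.
by case=> [d|u]; rewrite open_alphaE /= ?ia' ?a_new //; case: u.
Qed.

End Closing.

(** * Counting isomorphism classes *)

(** Classes are compared through a relation between representatives, so no map on quotients has to
    be defined. The partner chosen for [x] may vary within a class; this can only enlarge the image
    of [G], which is harmless for an upper bound. *)
Lemma leq_card_classes (T U : finType) (e : rel T) (e' : rel U)
    (A : {set T}) (B : {set U}) (R : T -> U -> Prop) :
  equivalence_rel e -> equivalence_rel e' ->
  {in A, forall x, exists2 y, y \in B & R x y} ->
  {in A &, forall x1 x2, {in B &, forall y1 y2,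
    R x1 y1 -> R x2 y2 -> e' y1 y2 -> e x1 x2}} ->
  #|equivalence_partition e A| <= #|equivalence_partition e' B|.
Proof.
move=> eE e'E total compat; rewrite /equivalence_partition.
set cl := fun y => [set z in B | e' y z].
have /fin_all_exists[G GP] x : exists Y : {set U}, x \in A ->
    exists y, [/\ y \in B, R x y & Y = cl y].
  have [/total[y yB xy]|_] := boolP (x \in A); last by exists set0.
  by exists (cl y) => _; exists y.
apply: leq_trans (_ : #|G @: A| <= _).
  apply: leq_card_imset_ker => x1 x2 x1A x2A G12.
  have [[y1 [y1B xy1 G1]] [y2 [y2B xy2 G2]]] := (GP _ x1A, GP _ x2A).
  have e12 : e x1 x2.
    apply: (compat _ _ x1A x2A _ _ y1B y2B) => //.
    have : y2 \in cl y2 by rewrite inE y2B (e'E y2 y2 y2).1.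
    by rewrite -G2 -G12 G1 inE => /andP[].
  by apply/setP=> z; rewrite !inE (eE x1 x2 z).2.
apply: subset_leq_card; apply/subsetP=> _ /imsetP[x xA ->].
by have [y [yB _ ->]] := GP _ xA; apply: imset_f.
Qed.

Lemma card_classes_split (T : finType) (e : rel T) (A : {set T}) (P : pred T) :
  equivalence_rel e -> {in A &, forall x y, e x y -> P x = P y} ->
  #|equivalence_partition e A| =
  #|equivalence_partition e [set x in A | P x]| +
  #|equivalence_partition e [set x in A | ~~ P x]|.
Proof.
move=> eE Pe; pose cl x := [set y in A | e x y].
have clE (Q : pred T) : {in A &, forall x y, e x y -> Q x = Q y} ->
    equivalence_partition e [set x in A | Q x] = cl @: [set x in A | Q x].
  move=> Qe; apply: eq_in_imset => x; rewrite inE => /andP[xA Qx].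
  apply/setP=> y; rewrite !inE; have [yA|//] /= := boolP (y \in A).
  by case exy: (e x y); rewrite ?andbF // -(Qe x y) ?Qx.
rewrite !clE // => [|x y xA yA exy]; last by rewrite (Pe x y).
rewrite -cardsUI -imsetU (_ : _ :|: _ = A); last first.
  by apply/setP=> x; rewrite !inE -andb_orr orbN andbT.
rewrite (_ : _ :&: _ = set0) ?cards0 ?addn0 //.
apply/setP=> X; rewrite !inE; apply/andP=> -[/imsetP[x + ->] /imsetP[y]].
rewrite !inE => /andP[xA Px] /andP[yA /negP Py] clxy; apply: Py.
have : y \in cl y by rewrite inE yA (eE y y y).1.
by rewrite -clxy inE => /andP[_ /Pe <-].
Qed.

Lemma rot_isom_transport (D E : finType) (m : rotation D) :
  #|D| = #|E| -> exists (n : rotation E) f, rot_isom m n f.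
Proof.
move=> DE.
pose f (d : D) : E := enum_val (cast_ord DE (enum_rank d)).
pose g (e : E) : D := enum_val (cast_ord (esym DE) (enum_rank e)).
have fK : cancel f g by move=> d; rewrite /f /g enum_valK cast_ordK enum_rankK.
have gK : cancel g f by move=> d; rewrite /f /g enum_valK cast_ordKV enum_rankK.
have conj (s : {perm D}) : exists s' : {perm E}, forall e, g (s' e) = s (g e).
  apply: restrict_perm (can_inj gK) _ => e; by exists (f (s (g e))); rewrite fK.
have [[s' sE] [a' aE]] := (conj (sigma m), conj (alpha m)).
exists (s', a', f (root_dart m)), f; split=> // [|d|d]; first by exists g.
  by rewrite -{1}[d]fK -sE gK.
by rewrite -{1}[d]fK -aE gK.
Qed.

Section Reversal.

Variable D : finType.

Definition reverse_root (m : rotation D) : rotation D :=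
  (sigma m, alpha m, alpha m (root_dart m)).

Lemma reverse_rootK (m : rotation D) :
  involutive (alpha m) -> reverse_root (reverse_root m) = m.
Proof. by case: m => [[s a] r] aK; congr (_, _); apply: aK. Qed.

Lemma dart_G_reverse (m : rotation D) : dart_G m -> dart_G (reverse_root m).
Proof.
case=> aK an cm nl f3 eu dg; split=> // d /dg.
rewrite -[root_dart (reverse_root m)]/(alpha m (root_dart m)).
by rewrite -[alpha (reverse_root m) _]/(alpha m _) aK orbC.
Qed.

Lemma rot_isom_reverse (m n : rotation D) f : dart_G m -> dart_G n ->
  rot_isom m n f <-> rot_isom (reverse_root m) (reverse_root n) f.
Proof.
move=> mG nG; split=> -[bf fs fa fr]; split=> //; first by rewrite fa fr.
by have := congr1 (alpha n) fr; rewrite -fa [alpha m _](dart_alphaK mG) [RHS](dart_alphaK nG).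
Qed.

End Reversal.

(** The equation also allows degree 1, but under [dart_G] this is excluded, as in [xr]. *)
Definition root_degree2 (D : finType) (m : rotation D) : bool :=
  sigma m (sigma m (root_dart m)) == root_dart m.

Lemma in_GP (D : finType) (m : rooted_map D) : reflect (dart_G m) (in_G m).
Proof. by apply: (iffP idP) => [/in_G_dart_G|/dart_G_in_G]. Qed.

Lemma dart_G_map (D : finType) (m : rotation D) :
  dart_G m -> exists2 n : rooted_map D, rotation_of n = m & in_G n.
Proof. by move=> mG; exists (RootedMap (dart_G_planar mG)); last exact/in_GP. Qed.

Lemma root_degree2_isom (D E : finType) (m : rotation D) (n : rotation E) f :
  rot_isom m n f -> root_degree2 m = root_degree2 n.
Proof.
case=> bf fs _ fr.
by rewrite /root_degree2 -(inj_eq (bij_inj bf)) !fs fr.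
Qed.

Definition class_count (D : finType) (P : pred (rooted_map D)) : nat :=
  #|equivalence_partition (@map_iso D) [set m | P m]|.

Section Counting.

Variable D : finType.
Implicit Types m n : rooted_map D.

Lemma eq_class_count (P Q : pred (rooted_map D)) :
  P =1 Q -> class_count P = class_count Q.
Proof.
by move=> PQ; rewrite /class_count; have -> : [set m | P m] = [set m | Q m]
  by apply/setP=> m; rewrite !inE.
Qed.

Lemma in_GstarE m :
  in_Gstar m = [&& in_G m, ~~ root_degree2 m & ~~ root_degree2 (reverse_root m)].
Proof.
have mem_vert d : porbit (sigma m) d \in vertices m by apply: imset_f.
have deg3 d : (3 <= degree (porbit (sigma m) d)) = (sigma m (sigma m d) != d).
  by rewrite leqNgt card_porbit_lt3.
apply/idP/and3P => [/and3P[tr ns /forall_inP dg]|[/and3P[tr ns /forall_inP dg] rd rd']].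
  rewrite /root_degree2 -!deg3 !dg //; split=> //.
  rewrite /in_G tr ns; apply/forall_inP=> v /dg ->; exact: implybT.
rewrite /in_Gstar tr ns; apply/forall_inP=> v vm.
have := dg v vm; have [|//] := boolP (incident_to_root m v).
case/imsetP: vm => d _ ->; rewrite /incident_to_root -!eq_porbit_mem.
by case/orP=> /eqP <- _; rewrite deg3.
Qed.

Lemma class_count_reverse :
  class_count (fun m => in_G m && root_degree2 (reverse_root m)) =
  class_count (fun m => in_G m && root_degree2 m).
Proof.
have rrK m : in_G m -> reverse_root (reverse_root m) = m.
  by move/in_GP/dart_alphaK/reverse_rootK.
pose R m n := rotation_of n = reverse_root m.
have compat m1 m2 n1 n2 : in_G m1 -> in_G m2 -> R m1 n1 -> R m2 n2 ->
    map_iso n1 n2 -> map_iso m1 m2.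
  move=> /in_GP mG1 /in_GP mG2 r1 r2 /map_isoP[f]; rewrite r1 r2.
  by move/(rot_isom_reverse _ mG1 mG2) => i; apply/map_isoP; exists f.
have total m : in_G m -> exists2 n, in_G n & R m n.
  by move=> /in_GP/dart_G_reverse/dart_G_map[n rn nG]; exists n.
apply/eqP; rewrite eqn_leq; apply/andP; split;
  apply: (leq_card_classes (R := R)); try exact: map_iso_equiv.
- move=> m; rewrite inE => /andP[mG rd]; have [n nG mn] := total m mG.
  by exists n; rewrite // inE nG mn.
- move=> m1 m2; rewrite !inE => /andP[mG1 _] /andP[mG2 _] n1 n2 _ _.
  exact: compat.
- move=> m; rewrite inE => /andP[mG rd]; have [n nG mn] := total m mG.
  by exists n; rewrite // inE nG mn rrK.
- move=> m1 m2; rewrite !inE => /andP[mG1 _] /andP[mG2 _] n1 n2 _ _.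
  exact: compat.
Qed.

(** Splitting by the degree of the origin, then of the other end, leaves G*. The two exceptional
    parts are disjoint by [root_ends_degree] and equinumerous by [class_count_reverse], whence the
    factor 2. *)
Lemma class_count_G :
  class_count (@in_G D) =
  class_count (@in_Gstar D) + 2 * class_count (fun m => in_G m && root_degree2 m).
Proof.
have inv m n : map_iso m n -> root_degree2 m = root_degree2 n.
  by case/map_isoP=> f /root_degree2_isom.
have inv_rev m n : in_G m -> in_G n -> map_iso m n ->
    root_degree2 (reverse_root m) = root_degree2 (reverse_root n).
  move=> /in_GP mG /in_GP nG /map_isoP[f] /(rot_isom_reverse _ mG nG).
  exact: root_degree2_isom.
have split_classes (P Q : pred (rooted_map D)) :
    {in P &, forall m n, map_iso m n -> Q m = Q n} -> class_count P =
    class_count (fun m => P m && Q m) + class_count (fun m => P m && ~~ Q m).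
  have setE (S : pred (rooted_map D)) :
      [set m in [set m | P m] | S m] = [set m | P m && S m].
    by apply/setP=> m; rewrite !inE.
  move=> PQ; rewrite /class_count (card_classes_split (P := Q)) ?setE //.
  - exact: map_iso_equiv.
  by move=> m n; rewrite !inE; apply: PQ.
rewrite (split_classes _ (fun m => root_degree2 m)); last first.
  by move=> m n _ _ /inv.
rewrite (split_classes (fun m => in_G m && ~~ root_degree2 m)
  (fun m => root_degree2 (reverse_root m))); last first.
  by move=> m n /andP[mG _] /andP[nG _]; apply: inv_rev.
rewrite mulSn mul1n [RHS]addnC -addnA; congr (_ + (_ + _)).
  rewrite -class_count_reverse; apply: eq_class_count => m.
  rewrite -andbA; apply: andb_id2l => /in_GP mG.
  have [/eqP rd|//] := boolP (root_degree2 m).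
  exact/esym/negbTE/(root_ends_degree mG rd).
by apply: eq_class_count => m; rewrite in_GstarE andbA.
Qed.

End Counting.

(** The same relation bounds the counts both ways: it is total by [close_map] and by transporting
    [open_map], and respects isomorphism by [rot_isom_open] and [open_rot_isom]. *)
Lemma class_count_open (D E : finType) : #|E| = #|D| + 6 ->
  class_count (fun m : rooted_map E => in_G m && root_degree2 m) =
  class_count (@in_G D).
Proof.
move=> card_E.
pose R (m : rooted_map E) (n : rooted_map D) := exists g, rot_isom (open_map n) m g.
apply/eqP; rewrite eqn_leq; apply/andP; split.
- apply: (leq_card_classes (R := R)); try exact: map_iso_equiv.
  + move=> m; rewrite inE => /andP[/in_GP mG /eqP rd].
    have [n0 [g ng]] := close_map mG card_E rd.
    have [|n nE nG] := @dart_G_map _ n0.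
      by apply/dart_G_open; have [h /rot_isom_dart_G] := rot_isom_inv ng; apply.
    by exists n; rewrite ?inE // /R nE; exists g.
  move=> m1 m2 _ _ n1 n2 _ _ [g1 i1] [g2 i2] /map_isoP[f /rot_isom_open[h ih]].
  have [g1' i1'] := rot_isom_inv i1; apply/map_isoP.
  by have := rot_isom_comp (rot_isom_comp i1' ih) i2; eexists; eassumption.
apply: (leq_card_classes (R := fun n m => R m n)); try exact: map_iso_equiv.
- move=> n; rewrite inE => /in_GP nG.
  have [|m0 [g mg]] := @rot_isom_transport _ E (open_map n).
    by rewrite card_open_dart.
  have [|m mE mG] := @dart_G_map _ m0.
    by apply: rot_isom_dart_G mg _; apply/dart_G_open.
  exists m; last by rewrite /R mE; exists g.
  by rewrite inE mG mE -(root_degree2_isom mg) /root_degree2 !open_sigmaE.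
move=> n1 n2; rewrite !inE => /in_GP nG1 /in_GP nG2 m1 m2 _ _.
move=> [g1 i1] [g2 i2] /map_isoP[f i12]; apply/map_isoP.
have [g2' i2'] := rot_isom_inv i2.
exact: open_rot_isom nG1 nG2 (rot_isom_comp (rot_isom_comp i1 i12) i2').
Qed.

(** There is no root dart to choose, so both series have constant term 0. *)
Lemma class_count0 (P : pred (rooted_map 'I_0)) : class_count P = 0.
Proof.
apply/eqP; rewrite cards_eq0; apply/eqP/setP=> X; rewrite inE.
by apply/imsetP=> -[m]; case: (root_dart m).
Qed.

Theorem theorem7 :
  Gstar_series =1 series_mul (series_of_poly (1 - 2%:P * 'X)%R) G_series.
Proof.
have GE n : G_series n = Posz (class_count (@in_G 'I_(2 * (3 * n)))) by [].
have GsE n : Gstar_series n = Posz (class_count (@in_Gstar 'I_(2 * (3 * n)))) by [].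
have coefE i : series_of_poly (1 - 2%:P * 'X)%R i =
    (if i == 0%N then 1 else if i == 1%N then - 2 else 0)%R.
  rewrite /series_of_poly coefB coef1 coefCM coefX.
  by case: i => [|[|i]].
case=> [|n]; rewrite /series_mul big_ord_recl.
  by rewrite big_ord0 GsE subn0 GE !class_count0 coefE.
rewrite big_ord_recl big1 => [|i _]; last by rewrite coefE mul0r.
have := class_count_G 'I_(2 * (3 * n.+1)).
(* Six darts fewer are three edges fewer, hence one degree less in t: this is the factor t of 2t. *)
rewrite (@class_count_open 'I_(2 * (3 * n))); last by rewrite !card_ord; lia.
rewrite !coefE /= subn0 !GE GsE /bump /= subSS subn0 => ->.
lia.
Qed.
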